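(* Let $\Phi,\Psi\in\{\Gamma_k,\mathcal{K}\}$ and $\star\in\{1,fin\}$. Then for a space $X$ the following statements are equivalent: (1) $X$ satisfies $S_\star(\Phi,\Psi)$; (2) the hyperspace $(2^X,\mathbf{F}^+)$ satisfies $S_\star(\mathcal{D}_\Phi,\mathcal{D}_\Psi)$.
   Context: Standing assumption: all spaces are Hausdorff and non-compact unless otherwise stated. For a space $X$, $2^X$ is the family of all closed subsets of $X$ (including $\emptyset$). For $A\subseteq X$ put $A^c=X\setminus A$ and $A^+=\{F\in 2^X: F\subseteq A\}$. The upper Fell topology $\mathbf{F}^+$ on $2^X$ has base $\{(D^c)^+: D\subseteq X \text{ non-empty compact}\}\cup\{2^X\}$. Covers are non-trivial: $\mathcal{U}$ is a cover of $X$ if $X=\bigcup\mathcal{U}$ and $X\notin\mathcal{U}$. An open cover $\mathcal{U}$ of $X$ is a $k$-cover if each compact subset of $X$ is contained in an element of $\mathcal{U}$; it is a $\gamma_k$-cover if it is infinite and for each compact $C\subseteq X$ the set $\{U\in\mathcal{U}: C\not\subseteq U\}$ is finite. $\mathcal{K}$ and $\Gamma_k$ are the families of all open $k$-covers, respectively open $\gamma_k$-covers, of $X$. Selection principles: $S_1(\mathcal{A},\mathcal{B})$ says that for each sequence $(A_n)_{n\in\mathbb{N}}$ of elements of $\mathcal{A}$ there are $b_n\in A_n$ ($n\in\mathbb{N}$) such that $\{b_n:n\in\mathbb{N}\}\in\mathcal{B}$. $S_{fin}(\mathcal{A},\mathcal{B})$ says that for each sequence $(A_n)_{n\in\mathbb{N}}$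 of elements of $\mathcal{A}$ there are finite sets $B_n\subseteq A_n$ such that $\bigcup_{n\in\mathbb{N}}B_n\in\mathcal{B}$. For $(2^X,\mathbf{F}^+)$: $\mathcal{D}_{\mathcal{K}}$ (also written $\mathcal{D}_\Omega$) is the family of all dense subsets $\mathcal{A}$ of $(2^X,\mathbf{F}^+)$ with $\emptyset\notin\mathcal{A}$. $\mathcal{D}_{\Gamma_k}$ (also written $\mathcal{D}_\Gamma$) is the family of all infinite $\mathcal{A}\subseteq 2^X$ with $\emptyset\notin\mathcal{A}$ that converge to $\{\emptyset\}$, meaning that for every $F\in 2^X$ and every $\mathbf{F}^+$-neighborhood $W$ of $F$ the set $\{A\in\mathcal{A}: A\notin W\}$ is finite. *)

(* Defs.v *)
From HB Require Import structures.
From mathcomp Require Import all_boot.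
From mathcomp Require Import boolp classical_sets functions cardinality.
From mathcomp Require Import filter topology.

Set Implicit Arguments.
Unset Strict Implicit.
Unset Printing Implicit Defensive.

Local Open Scope classical_set_scope.

Record hyperspace (X : topologicalType) : Type := ClosedSet {
  closed_carrier :> set X;
  closed_carrierP : closed closed_carrier }.

HB.instance Definition _ (X : topologicalType) := gen_eqMixin (hyperspace X).
HB.instance Definition _ (X : topologicalType) :=
  gen_choiceMixin (hyperspace X).

Lemma closed_carrier_inj (X : topologicalType) :
  injective (@closed_carrier X).
Proof.
move=> [F cF] [G cG] /= eFG; subst G; congr ClosedSet.
exact: Prop_irrelevance.
Qed.

Definition emptyF (X : topologicalType) : hyperspace X := ClosedSet closed0.
Arguments emptyF {X}.

(** $A^+$ *)
Definition upset (X : topologicalType) (A : set X) : set (hyperspace X) :=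
  [set F | closed_carrier F `<=` A].

Definition upper_fell_base (X : topologicalType) : set (set (hyperspace X)) :=
  [set upset (~` D) | D in [set D : set X | D !=set0 /\ compact D]]
  `|` [set setT].
Arguments upper_fell_base X : clear implicits.

Section upper_fell_topology.
Variable X : topologicalType.

Let base_cover :
  \bigcup_(B in upper_fell_base X) B = [set: hyperspace X].
Proof. by rewrite eqEsubset; split => // F _; exists setT => //; right. Qed.

Let base_join (B C : set (hyperspace X)) (F : hyperspace X) :
  upper_fell_base X B -> upper_fell_base X C -> B F -> C F ->
  exists E, [/\ upper_fell_base X E, E F & E `<=` B `&` C].
Proof.
move=> bB bC BF CF; case: (bB) => [[D [D0 cD] eB]|/= eB]; last first.
  by exists C; split => // G CG; split => //; rewrite eB.
case: (bC) => [[D' [_ cD'] eC]|/= eC]; last first.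
  by exists B; split => // G BG; split => //; rewrite eC.
exists (upset (~` (D `|` D'))); split.
- left; exists (D `|` D') => //; split; last exact: compactU.
  by case: D0 => x Dx; exists x; left.
- move=> x Fx; rewrite setCU; split.
    by move: BF; rewrite -eB => /(_ _ Fx).
  by move: CF; rewrite -eC => /(_ _ Fx).
- move=> G GDD'; rewrite -eB -eC; split=> x /GDD'; rewrite setCU;
    by case.
Qed.

HB.instance Definition _ := @isBaseTopological.Build (hyperspace X)
  (set (hyperspace X)) (upper_fell_base X) id base_cover base_join.

End upper_fell_topology.

Lemma upper_fell_openP (X : topologicalType) (O : set (hyperspace X)) :
  open O <-> exists2 S, S `<=` upper_fell_base X & O = \bigcup_(B in S) B.
Proof. by split=> [[S sS <-]|[S sS ->]]; exists S. Qed.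

Definition nontrivial_cover (X : Type) (U : set (set X)) : Prop :=
  \bigcup_(V in U) V = setT /\ ~ U setT.

Definition open_cover (X : topologicalType) (U : set (set X)) : Prop :=
  nontrivial_cover U /\ U `<=` open.

Definition k_cover (X : topologicalType) : set (set (set X)) :=
  [set U | open_cover U /\
    forall C : set X, compact C -> exists2 V, U V & C `<=` V].
Arguments k_cover X : clear implicits.

Definition gamma_k_cover (X : topologicalType) : set (set (set X)) :=
  [set U | [/\ open_cover U, infinite_set U &
    forall C : set X, compact C -> finite_set [set V | U V /\ ~ (C `<=` V)]]].
Arguments gamma_k_cover X : clear implicits.

Definition converges_to_empty (X : topologicalType)
    (A : set (hyperspace X)) : Prop :=
  forall (F : hyperspace X) (W : set (hyperspace X)),
    nbhs F W -> finite_set [set G | A G /\ ~ W G].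

Definition D_k (X : topologicalType) : set (set (hyperspace X)) :=
  [set A | dense A /\ ~ A emptyF].
Arguments D_k X : clear implicits.

Definition D_gamma_k (X : topologicalType) : set (set (hyperspace X)) :=
  [set A | [/\ infinite_set A, ~ A emptyF & converges_to_empty A]].
Arguments D_gamma_k X : clear implicits.

Definition S1 (T : Type) (A B : set (set T)) : Prop :=
  forall a : nat -> set T, (forall n, A (a n)) ->
    exists b : nat -> T, (forall n, a n (b n)) /\ B (range b).

Definition Sfin (T : Type) (A B : set (set T)) : Prop :=
  forall a : nat -> set T, (forall n, A (a n)) ->
    exists b : nat -> set T,
      (forall n, finite_set (b n) /\ b n `<=` a n) /\ B (\bigcup_n b n).

Inductive cover_symbol := Gamma_k | K.

Definition covers (Phi : cover_symbol) (X : topologicalType) :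
    set (set (set X)) :=
  match Phi with Gamma_k => gamma_k_cover X | K => k_cover X end.
Arguments covers Phi X : clear implicits.

Definition D_ (Phi : cover_symbol) (X : topologicalType) :
    set (set (hyperspace X)) :=
  match Phi with Gamma_k => D_gamma_k X | K => D_k X end.
Arguments D_ Phi X : clear implicits.

Inductive selection_symbol := star_1 | star_fin.

Definition S_ (star : selection_symbol) (T : Type) (A B : set (set T)) : Prop :=
  match star with star_1 => S1 A B | star_fin => Sfin A B end.

(* Main.v *)
(** Complementation identifies the closed sets with the open sets.  Under it a
    closed set lies in the basic neighbourhood $(C^c)^+$ exactly when its
    complement contains the compact set $C$, so dense families correspond to
    $k$-covers and families converging to $\emptyset$ to $\gamma_k$-covers;
    the selection principles are transported along this bijection. *)
Require Import Defs.
From mathcomp Require Import all_boot.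
From mathcomp Require Import boolp classical_sets functions cardinality.
From mathcomp Require Import filter topology.

Local Open Scope classical_set_scope.

Lemma finite_image_inj (T U : Type) (f : T -> U) (A : set T) :
  injective f -> finite_set (f @` A) -> finite_set A.
Proof.
move=> f_inj /(@finite_preimage _ _ _ f) fin.
by apply: sub_finite_set (fin _) => [|x y _ _ /f_inj//]; exact: preimage_image.
Qed.

Section selection_transport.
Variables (T T' : Type) (f : T -> T') (A B : set (set T)) (A' B' : set (set T')).
Hypothesis f_inj : injective f.
Hypothesis A'_range : forall s, A' s -> s `<=` range f.
Hypothesis imageA : forall s, A' (f @` s) <-> A s.
Hypothesis imageB : forall s, B' (f @` s) <-> B s.

Let image_preimage_range (s : set T') : s `<=` range f -> f @` (f @^-1` s) = s.
Proof.
move=> sf; rewrite eqEsubset; split=> [|y sy]; first exact: image_preimage_subset.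
by have [x _ fx] := sf _ sy; exists x => //; rewrite /preimage/= fx.
Qed.

(** The map [f] is injective but may fail to be onto. Members of [A'] lie in its range, so they are
    recovered from their preimages, and [imageA] can be read backwards. *)
Let preimageA (s : set T') : A' s -> A (f @^-1` s).
Proof. by move=> A's; apply/imageA; rewrite image_preimage_range //; exact: A'_range. Qed.

Lemma S1_transport : S1 A' B' <-> S1 A B.
Proof.
split=> [S a Aa|S a' A'a'].
- have [n|b' [ab' B'b']] := S (fun n => f @` a n); first exact/imageA.
  have /choice[b bP] : forall n, exists x, a n x /\ f x = b' n.
    by move=> n; have [x ax fx] := ab' n; exists x.
  exists b; split=> [n|]; first by case: (bP n).
  apply/imageB; rewrite image_comp.
  suff -> : f \o b = b' by [].
  by apply/funext => n /=; case: (bP n).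
- have [n|b [ab Bb]] := S (fun n => f @^-1` a' n); first exact: preimageA.
  exists (f \o b); split=> [n|]; first exact: ab.
  by rewrite -(image_comp b f); apply/imageB.
Qed.

Lemma Sfin_transport : Sfin A' B' <-> Sfin A B.
Proof.
split=> [S a Aa|S a' A'a'].
- have [n|b' [ab' B'b']] := S (fun n => f @` a n); first exact/imageA.
  have fb' n : f @` (f @^-1` b' n) = b' n.
    apply: image_preimage_range => y /(proj2 (ab' n))[x _ <-].
    by exists x.
  exists (fun n => f @^-1` b' n); split=> [n|].
    have [fin_b' sub_b'] := ab' n; split.
      by apply: finite_preimage fin_b' => x y _ _ /f_inj.
    by move=> x /sub_b'[y ay /f_inj <-].
  by apply/imageB; rewrite image_bigcup (eq_bigcupr (fun n _ => fb' n)).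
- have [n|b [ab Bb]] := S (fun n => f @^-1` a' n); first exact: preimageA.
  exists (fun n => f @` b n); split=> [n|].
    have [fin_b sub_b] := ab n; split; first exact: finite_image.
    by move=> _ [x /sub_b ? <-].
  by rewrite -image_bigcup; apply/imageB.
Qed.

Lemma S_transport star : S_ star A' B' <-> S_ star A B.
Proof. by case: star; [exact: S1_transport|exact: Sfin_transport]. Qed.

End selection_transport.

Section complement.
Variable X : topologicalType.
Implicit Types (F : hyperspace X) (A : set (hyperspace X)) (C : set X).

Definition co_carrier F : set X := ~` closed_carrier F.

Lemma co_carrier_inj : injective co_carrier.
Proof. by move=> F G /setC_inj /closed_carrier_inj. Qed.

Lemma open_co_carrier F : open (co_carrier F).
Proof. exact/closed_openC/closed_carrierP. Qed.

Lemma open_range_co_carrier (V : set X) : open V -> range co_carrier V.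
Proof.
move=> oV; exists (ClosedSet (open_closedC oV)) => //.
exact: setCK.
Qed.

Lemma upsetCE C F : upset (~` C) F <-> C `<=` co_carrier F.
Proof. by exact: subsetCPr. Qed.

(** This matches the non-triviality of covers with the exclusion of the empty closed set from the
    hyperspace families. *)
Lemma co_carrier_setT A : (co_carrier @` A) setT <-> A emptyF.
Proof.
have co0 : co_carrier emptyF = setT by exact: setC0.
split=> [[F AF]|A0]; last by exists emptyF.
by rewrite -co0 => /co_carrier_inj <-.
Qed.

Lemma open_upset C : C !=set0 -> compact C -> open (upset (~` C)).
Proof.
move=> C0 cC; apply/upper_fell_openP; exists [set upset (~` C)].
  by move=> _ ->; left; exists C.
by rewrite bigcup_set1.
Qed.

(** Allowing [C] to be empty treats both kinds of base element alike: [setT] is the [upset] of the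
    complement of the empty set. *)
Lemma nbhs_upset F (W : set (hyperspace X)) : nbhs F W ->
  exists C, [/\ compact C, upset (~` C) F & upset (~` C) `<=` W].
Proof.
rewrite nbhsE => -[O [/upper_fell_openP[S sS ->] [B SB BF]] OW].
have BW : B `<=` W by move=> G BG; apply: OW; exists B.
case: (sS _ SB) => [[D [_ cD] eB]|/= eB].
  by exists D; split=> //; rewrite eB.
exists set0; split; first exact: compact0.
  by apply/upsetCE; exact: sub0set.
- by move=> G _; apply: BW; rewrite eB.
Qed.

Lemma open_cover_co_carrier A :
  (forall x, exists2 F, A F & [set x] `<=` co_carrier F) ->
  ~ A emptyF -> open_cover (co_carrier @` A).
Proof.
move=> coverA A0; split; last by move=> _ [F _ <-]; exact: open_co_carrier.
split; last by move/co_carrier_setT.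
rewrite eqEsubset; split=> // x _; have [F AF xF] := coverA x.
by exists (co_carrier F); [exists F|exact: xF].
Qed.

Lemma k_cover_co_carrier A : k_cover X (co_carrier @` A) <-> D_k X A.
Proof.
split=> [[[[_ nT] _] kA]|[dA A0]].
- split; last by move/co_carrier_setT.
  move=> O [F OF] oO.
  have [C [cC _ CO]] := nbhs_upset _ _ (open_nbhs_nbhs (conj oO OF)).
  have [_ [G AG <-] CG] := kA C cC.
  by exists G; split=> //; apply: CO; apply/upsetCE.
- have kA C : compact C -> exists2 F, A F & C `<=` co_carrier F.
    (* [open_upset] requires a non-empty compact set. For the empty one any member of [A] will do,
       and density in [setT] provides one. *)
    move=> cC; have [->|C0] := eqVneq C set0.
      have [|F [_ AF]] := dA setT _ openT; first by exists emptyF.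
      by exists F => //; exact: sub0set.
    have /set0P C0' := C0.
    have [|F [/upsetCE CF AF]] := dA _ _ (open_upset C C0' cC); last by exists F.
    (* Density only speaks of non-empty open sets; the empty closed set lies in every [upset]. *)
    by exists emptyF; exact: sub0set.
  split; first by apply: open_cover_co_carrier => // x; exact/kA/compact_set1.
  by move=> C /kA[F AF CF]; exists (co_carrier F) => //; exists F.
Qed.

Lemma infinite_co_carrier A :
  infinite_set (co_carrier @` A) <-> infinite_set A.
Proof.
split=> infA finA; apply: infA; first exact: finite_image.
exact: finite_image_inj co_carrier_inj finA.
Qed.

(** The exceptional sets of the two notions correspond under an injection, so finiteness passes both
    ways. *)
Lemma co_carrier_missing A C :
  [set V | (co_carrier @` A) V /\ ~ (C `<=` V)] =
  co_carrier @` [set F | A F /\ ~ upset (~` C) F].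
Proof.
rewrite eqEsubset; split=> [_ [[F AF <-] nCF]|_ [F [AF nCF] <-]].
  by exists F => //; split=> // /upsetCE.
by split; [exists F|move/upsetCE].
Qed.

Lemma gamma_k_cover_co_carrier A :
  gamma_k_cover X (co_carrier @` A) <-> D_gamma_k X A.
Proof.
split=> [[[[_ nT] _] /infinite_co_carrier infA gA]|[infA A0 cvA]].
- split=> //; first by move/co_carrier_setT.
  move=> F W /nbhs_upset[C [cC _ CW]]; have := gA C cC.
  rewrite co_carrier_missing => /(finite_image_inj _ _ _ _ co_carrier_inj).
  apply: sub_finite_set => G [AG nWG].
  by split=> // /CW.
- have gA C : compact C -> finite_set [set F | A F /\ ~ upset (~` C) F].
    move=> cC; have [->|/set0P C0] := eqVneq C set0.
      apply: sub_finite_set (finite_set0 _) => F [_]; apply.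
      by apply/upsetCE; exact: sub0set.
    (* Convergence is tested at the empty closed set, of which every such basic open set is a
       neighbourhood. *)
    apply: (cvA emptyF); apply: open_nbhs_nbhs; split; first exact: open_upset.
    exact: sub0set.
  split; last first.
  + by move=> C /gA fin; rewrite co_carrier_missing; exact: finite_image.
  + exact/infinite_co_carrier.
  (* If no complement contained [x], all of [A] would be exceptional for the compact set [[set x]],
     hence finite. *)
  apply: open_cover_co_carrier => // x; apply: contrapT => nex.
  apply: infA; have := gA _ (@compact_set1 X x).
  apply: sub_finite_set => F AF.
  by split=> // /upsetCE xF; apply: nex; exists F.
Qed.

Lemma covers_co_carrier (Phi : cover_symbol) A :
  covers Phi X (co_carrier @` A) <-> D_ Phi X A.
Proof.
by case: Phi; [exact: gamma_k_cover_co_carrier|exact: k_cover_co_carrier].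
Qed.

Lemma covers_open (Phi : cover_symbol) (U : set (set X)) :
  covers Phi X U -> U `<=` open.
Proof. by case: Phi => [[[]]|[[]]]. Qed.

End complement.

Theorem theorem4p2 (Phi Psi : cover_symbol) (star : selection_symbol)
  (X : topologicalType) (hX : hausdorff_space X)
  (ncX : ~ compact [set: X]) :
  S_ star (covers Phi X) (covers Psi X) <-> S_ star (D_ Phi X) (D_ Psi X).
Proof.
apply: (@S_transport _ _ (@co_carrier X)).
- exact: co_carrier_inj.
(* Complements of closed sets are exactly the open sets, and covers consist of open sets; this is
   the range condition of the transport. *)
- by move=> U /covers_open oU V /oU; exact: open_range_co_carrier.
- exact: covers_co_carrier.
- exact: covers_co_carrier.
Qed.
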